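(* Let $f:X\to Y$ be a $1$-Lipschitz map from a geodesic metric space $X$ to a metric space $Y$, and let $m,k\in\mathbb{N}$. Suppose that for every $R>0$ the family $\{f^{-1}(B_R(y))\}_{y\in Y}$ satisfies the inequality $\operatorname{asdim}\le m$ uniformly, and that $\operatorname{coasdim}(Y)\le fin+k$. Then $\operatorname{coasdim}(X)\le fin+k(m+1)$.
   Context: $B_R(y)$ is the ball of radius $R$ about $y$ in $Y$. For subsets $U,V$ of a metric space $(X,d)$, $\operatorname{diam}U=\sup\{d(x,y):x,y\in U\}$ and $d(U,V)=\inf\{d(x,y):x\in U,y\in V\}$. A family $\mathcal{U}$ of subsets is $R$-bounded if $\operatorname{diam}U\le R$ for all $U\in\mathcal{U}$, uniformly bounded if it is $R$-bounded for some $R>0$, and $r$-disjoint if $d(U,V)\ge r$ for all $U\ne V$ in $\mathcal{U}$. $\bigcup\mathcal{U}$ denotes the union of the members of $\mathcal{U}$. $\operatorname{asdim}X\le n$ means: for every $r>0$ there are uniformly bounded, $r$-disjoint families $\mathcal{U}_0,\dots,\mathcal{U}_n$ of subsets of $X$ such that $\bigcup_{i=0}^n\mathcal{U}_i$ covers $X$. For a family $\{X_\alpha\}$ of metric spaces, $\operatorname{asdim}(X_\alpha)\le n$ uniformly means: for every $r>0$ there is $R>0$ such that for each $\alpha$ there are $r$-disjoint, $R$-bounded families $\mathcal{U}_\alpha^0,\dots,\mathcal{U}_\alpha^n$ of subsets of $X_\alpha$ whose union covers $X_\alpha$. $\operatorname{coasdim}(X)\le fin+k$ means that for every $n\in\mathbb{N}$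 there exist $R>0$, $m\in\mathbb{N}$ and $n$-disjoint, $R$-bounded families $\mathcal{U}_1,\dots,\mathcal{U}_k$ of subsets of $X$ such that $\operatorname{asdim}\big(X\setminus\bigcup(\bigcup_{i=1}^k\mathcal{U}_i)\big)\le m$. *)

(* Defs.v *)
From HB Require Import structures.
From mathcomp Require Import all_boot all_order all_algebra.
From mathcomp Require Import all_classical all_reals all_analysis.

Set Implicit Arguments.
Unset Strict Implicit.
Unset Printing Implicit Defensive.

Import Order.TTheory GRing.Theory Num.Theory.

Local Open Scope classical_set_scope.
Local Open Scope ring_scope.

(* diam is -oo on the empty set and +oo on unbounded sets; setdist is +oo when
   one of the two sets is empty. *)
Definition diam (R : realType) (T : metricType R) (U : set T) : \bar R :=
  ereal_sup [set (mdist p.1 p.2)%:E | p in U `*` U].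

Definition setdist (R : realType) (T : metricType R) (U V : set T) : \bar R :=
  ereal_inf [set (mdist p.1 p.2)%:E | p in U `*` V].

Definition bounded_family (R : realType) (T : metricType R) (b : R)
    (F : set (set T)) : Prop :=
  forall U, F U -> (diam U <= b%:E)%E.

Definition uniformly_bounded (R : realType) (T : metricType R)
    (F : set (set T)) : Prop :=
  exists2 b : R, 0 < b & bounded_family b F.

Definition disjoint_family (R : realType) (T : metricType R) (r : R)
    (F : set (set T)) : Prop :=
  forall U V, F U -> F V -> U <> V -> (r%:E <= setdist U V)%E.

Definition families_union (T : Type) (n : nat)
    (F : 'I_n -> set (set T)) : set T :=
  \bigcup_i \bigcup_(U in F i) U.

(* A metric space is represented as a subset A of an ambient metric space T,
   with the restricted distance; the whole space is setT. *)
Definition asdim_le (R : realType) (T : metricType R) (A : set T)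
    (n : nat) : Prop :=
  forall r : R, 0 < r ->
    exists F : 'I_n.+1 -> set (set T),
      [/\ forall i U, F i U -> U `<=` A,
          forall i, uniformly_bounded (F i),
          forall i, disjoint_family r (F i) &
          A `<=` families_union F].

Definition asdim_le_uniformly (R : realType) (T : metricType R) (I : Type)
    (A : I -> set T) (n : nat) : Prop :=
  forall r : R, 0 < r ->
    exists2 b : R, 0 < b & forall a : I,
      exists F : 'I_n.+1 -> set (set T),
        [/\ forall i U, F i U -> U `<=` A a,
            forall i, disjoint_family r (F i),
            forall i, bounded_family b (F i) &
            A a `<=` families_union F].

(* coasdim(T) <= fin + k *)
Definition coasdim_le_fin (R : realType) (T : metricType R) (k : nat) : Prop :=
  forall n : nat,
    exists (b : R) (m : nat) (F : 'I_k -> set (set T)),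
      [/\ 0 < b,
          forall i, disjoint_family n%:R (F i),
          forall i, bounded_family b (F i) &
          asdim_le (~` families_union F) m].

(* Any two points are joined by an isometric image of [0, d(x, y)]; the values
   of g outside this interval are irrelevant. *)
Definition geodesic (R : realType) (T : metricType R) : Prop :=
  forall x y : T, exists g : R -> T,
    [/\ g 0 = x, g (mdist x y) = y &
        forall s t : R, 0 <= s <= mdist x y -> 0 <= t <= mdist x y ->
          mdist (g s) (g t) = `|s - t|].

(* The library's k.-lipschitz is only available between normed modules. *)
Definition metric_lipschitz (R : realType) (X Y : metricType R) (L : R)
    (f : X -> Y) : Prop :=
  forall x x' : X, mdist (f x) (f x') <= L * mdist x x'.

Arguments coasdim_le_fin {R} T k.
Arguments geodesic {R} T.

(* Main.v *)
Require Import Defs.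
From HB Require Import structures.
From mathcomp Require Import all_boot all_order all_algebra.
From mathcomp Require Import all_classical all_reals all_analysis.

Set Implicit Arguments.
Unset Strict Implicit.
Unset Printing Implicit Defensive.

Import Order.TTheory GRing.Theory Num.Theory.

Local Open Scope classical_set_scope.
Local Open Scope ring_scope.

(** Pull a bounded r-disjoint cover of a part of Y back along f and cut each
    preimage by the m + 1 families of the ball containing the original set:
    sets over different members stay r-disjoint because f is 1-Lipschitz. This
    turns N families into N (m + 1). Applied to the k families of Y it gives
    the k (m + 1) families of X; the uncovered part of X is the preimage of the
    uncovered part of Y, and the same construction bounds its asymptotic
    dimension, where any finite bound is enough, so that no Hurewicz-type
    theorem is needed. *)

Lemma diam_leP (R : realType) (T : metricType R) (U : set T) (b : R) :
  (diam U <= b%:E)%E <-> forall x y, U x -> U y -> mdist x y <= b.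
Proof.
split=> [Ub x y Ux Uy | Ub].
  rewrite -lee_fin; apply: le_trans Ub.
  by apply: ereal_sup_ubound; exists (x, y).
by apply: ge_ereal_sup => _ [[x y] [/= Ux Uy] <-]; rewrite lee_fin; exact: Ub.
Qed.

Lemma setdist_geP (R : realType) (T : metricType R) (U V : set T) (r : R) :
  (r%:E <= setdist U V)%E <-> forall x y, U x -> V y -> r <= mdist x y.
Proof.
split=> [rUV x y Ux Vy | rUV].
  rewrite -lee_fin; apply: (le_trans rUV).
  by apply: ereal_inf_lbound; exists (x, y).
by apply: le_ereal_inf_tmp => _ [[x y] [/= Ux Vy] <-]; rewrite lee_fin; exact: rUV.
Qed.

Lemma disjoint_family_le (R : realType) (T : metricType R) (r s : R)
    (F : set (set T)) :
  r <= s -> disjoint_family s F -> disjoint_family r F.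
Proof.
move=> rs dF U V FU FV UV; apply: le_trans (dF _ _ FU FV UV).
by rewrite lee_fin.
Qed.

(** A set of diameter at most [b] lies in a ball about any of its points, and uniformity over the
    centres makes [c] depend on [b] and [r] alone. *)
Lemma asdim_preimage_bounded (R : realType) (X Y : metricType R) (f : X -> Y)
    (m : nat) (r b : R) :
  (forall s : R, 0 < s ->
     asdim_le_uniformly (fun y : Y => f @^-1` ball y s) m) ->
  0 < r -> 0 < b ->
  exists2 c : R, 0 < c & forall U : set Y, (diam U <= b%:E)%E ->
    exists E : 'I_m.+1 -> set (set X),
      [/\ forall j W, E j W -> W `<=` f @^-1` U,
          forall j, disjoint_family r (E j),
          forall j, bounded_family c (E j) &
          f @^-1` U `<=` families_union E].
Proof.
move=> fibers r0 b0.
(* The radius is [b + 1] because balls are open. The empty [U] offers no centre and is treated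
   apart. *)
have [c c0 Hc] := fibers _ (addr_gt0 b0 ltr01) _ r0.
exists c => // U /diam_leP Ub.
have [[y Uy]|U0] := pselect (U !=set0); last first.
  by exists (fun=> set0); split=> [? ? []|? ? ? []|? ? []|x Ux] //;
    case: U0; exists (f x).
have [E [_ disjE bE covE]] := Hc y.
(* Cutting down to the preimage of [U] is what later separates pieces lying over different
   members. *)
exists (fun j => [set f @^-1` U `&` V | V in E j]); split.
- by move=> j _ [V _ <-] x [].
- move=> j _ _ [V EV <-] [V' EV' <-] VV'; apply/setdist_geP.
  move=> x x' [_ Vx] [_ V'x'].
  have /setdist_geP := disjE j V V' EV EV' (fun e => VV' (congr1 _ e)).
  exact.
- move=> j _ [V EV <-]; apply/diam_leP => x x' [_ Vx] [_ Vx'].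
  by have /diam_leP := bE j V EV; exact.
- move=> x Ux; have [|j _ [V EV Vx]] := covE x.
    by rewrite /= ballEmdist /=; apply: le_lt_trans (Ub _ _ Uy Ux) _; rewrite ltrDl.
  by exists j => //; exists (f @^-1` U `&` V) => //; exists V.
Qed.

(** The union of [G] is given as an equality so that it serves both for complements and for keeping
    the pieces inside a preimage. *)
Lemma pullback_families (R : realType) (X Y : metricType R) (f : X -> Y)
    (m N : nat) (r b : R) (F : 'I_N -> set (set Y)) :
  metric_lipschitz 1 f ->
  (forall s : R, 0 < s ->
     asdim_le_uniformly (fun y : Y => f @^-1` ball y s) m) ->
  0 < r -> 0 < b ->
  (forall i, disjoint_family r (F i)) -> (forall i, bounded_family b (F i)) ->
  exists2 c : R, 0 < c & exists G : 'I_(N * m.+1) -> set (set X),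
    [/\ forall i, disjoint_family r (G i),
        forall i, bounded_family c (G i) &
        families_union G = f @^-1` families_union F].
Proof.
move=> lipf fibers r0 b0 disjF bF.
have [c c0 Hc] := asdim_preimage_bounded fibers r0 b0; exists c => //.
(* The diameter bound moves under the existential so that choice yields a total [E]; sets violating
   it get empty families. *)
have {Hc} /choice[E HE] (U : set Y) : exists E : 'I_m.+1 -> set (set X),
    (diam U <= b%:E)%E ->
    [/\ forall j W, E j W -> W `<=` f @^-1` U,
        forall j, disjoint_family r (E j),
        forall j, bounded_family c (E j) &
        f @^-1` U `<=` families_union E].
  have [/Hc[E HE]|Ub] := pselect (diam U <= b%:E)%E; first by exists E.
  by exists (fun=> set0).
(* [p] decodes a flat index into a pair (family of [F], family of [E]), undoing [mxvec_index]. *)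
pose p (l : 'I_(N * m.+1)) := enum_val (cast_ord (esym (mxvec_cast N m.+1)) l).
have pK i j : p (mxvec_index i j) = (i, j).
  by rewrite /p /mxvec_index cast_ordK enum_rankK.
exists (fun l => \bigcup_(U in F (p l).1) E U (p l).2); split.
- move=> l W W' [U FU EW] [U' FU' EW'] WW'.
  have [subU disjU _ _] := HE U (bF _ _ FU).
  have [UU'|UU'] := pselect (U = U').
    by apply: (disjU (p l).2) => //; rewrite UU'.
  have [subU' _ _ _] := HE U' (bF _ _ FU').
  apply/setdist_geP => x x' Wx W'x'.
  have /setdist_geP/(_ (f x) (f x')) dUU' := disjF _ _ _ FU FU' UU'.
  apply: le_trans (dUU' (subU _ _ EW _ Wx) (subU' _ _ EW' _ W'x')) _.
  by rewrite -[leRHS]mul1r.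
- by move=> l W [U FU EW]; have [_ _ bU _] := HE U (bF _ _ FU); exact: bU EW.
- apply/seteqP; split=> [x [l _ [W [U FU EW] Wx]]|x [i _ [U FU Ux]]].
    have [subU _ _ _] := HE U (bF _ _ FU).
    by exists (p l).1 => //; exists U => //; exact: subU EW _ Wx.
  have [_ _ _ covU] := HE U (bF _ _ FU).
  have [j _ [W EW Wx]] := covU x Ux.
  exists (mxvec_index i j) => //; exists W => //.
  by rewrite pK; exists U.
Qed.

(** Pulling back [n.+1] families gives [n.+1 * m.+1] of them, one more than the dimension, hence the
    predecessor. *)
Lemma asdim_le_preimage (R : realType) (X Y : metricType R) (f : X -> Y)
    (m n : nat) (A : set Y) :
  metric_lipschitz 1 f ->
  (forall s : R, 0 < s ->
     asdim_le_uniformly (fun y : Y => f @^-1` ball y s) m) ->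
  asdim_le A n -> asdim_le (f @^-1` A) (n.+1 * m.+1).-1.
Proof.
move=> lipf fibers asdimA r r0.
have [F [subF ubF disjF covF]] := asdimA r r0.
have {ubF} /choice[b Hb] i : exists b : R, 0 < b /\ bounded_family b (F i).
  by have [b b0 Fb] := ubF i; exists b.
(* The sum of the separate bounds serves as a common bound for all [F i]. *)
have bmax i : b i <= \sum_j b j.
  rewrite (bigD1 i) //= lerDl; apply: sumr_ge0 => j _.
  by have [/ltW] := Hb j.
have sum0 : 0 < \sum_j b j by apply: lt_le_trans (bmax ord0); case: (Hb ord0).
have bF i : bounded_family (\sum_j b j) (F i).
  move=> U FU; have [_ Fb] := Hb i.
  by apply: le_trans (Fb U FU) _; rewrite lee_fin.
have [c c0 [G [disjG bG unionG]]] := pullback_families lipf fibers r0 sum0 disjF bF.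
exists G; split=> //.
- move=> l W GW x Wx.
  have : (f @^-1` families_union F) x by rewrite -unionG; exists l => //; exists W.
  by move=> [i _ [U FU Ux]]; exact: subF FU _ Ux.
- by move=> l; exists c.
- by rewrite unionG => x Ax; exact: covF.
Qed.

Theorem theorem3p4 (R : realType) (X Y : metricType R) (f : X -> Y)
    (m k : nat)
    (geodX : geodesic X)
    (lipf : metric_lipschitz 1 f)
    (fibers : forall r : R, 0 < r ->
       asdim_le_uniformly (fun y : Y => f @^-1` ball y r) m)
    (coasdimY : coasdim_le_fin Y k) :
  coasdim_le_fin X (k * (m + 1))%N.
Proof.
rewrite addn1 => n.
(* [coasdimY] is used at n.+1, as [fibers] needs a positive distance. *)
have [b [q [F [b0 disjF bF asdimF]]]] := coasdimY n.+1.
have [c c0 [G [disjG bG unionG]]] :=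
  pullback_families lipf fibers (ltr0Sn R n) b0 disjF bF.
exists c, (q.+1 * m.+1).-1, G; split=> //.
- by move=> i; apply: disjoint_family_le (disjG i); rewrite ler_nat.
- by rewrite unionG preimage_setC; exact: asdim_le_preimage.
Qed.
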